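(* Let $(P,\leq)$ be a finite poset with $|P|=n$, $P=\{x_1,\ldots,x_n\}$, and let $\mathbf Z$ and $\overline{\mathbf Z}=\mathbf J-\mathbf Z$ be, respectively, its zeta matrix and its order-complement matrix. (a) The characteristic polynomial $p(\lambda)=\det(\overline{\mathbf Z}-\lambda\mathbf I)$ of $\overline{\mathbf Z}$ is $$p(\lambda)=(-1)^n(\lambda+1)^n-\sum_{k=0}^{n-1}(-1)^{k+n}c_k\,(\lambda+1)^{n-1-k},$$ where $c_k=\mathbf 1^T(\mathbf Z-\mathbf I)^k\mathbf 1$ is the number of chains of length $k$ in $P$. (b) The determinant of the order-complement matrix is $$\det\overline{\mathbf Z}=(-1)^{n+1}\tilde\chi(P),$$ where $\tilde\chi(P)$ is the reduced Euler characteristic of $P$.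
   Context: For a finite poset $P=\{x_1,\ldots,x_n\}$ (in any fixed enumeration of its elements), the zeta matrix $\mathbf Z$ is the $n\times n$ matrix with entries $z_{ij}=1$ if $x_i\leq x_j$ and $z_{ij}=0$ otherwise. $\mathbf J$ is the $n\times n$ matrix with all entries equal to $1$, $\mathbf I$ is the $n\times n$ identity matrix, and $\mathbf 1$ is the column vector of length $n$ with all entries equal to $1$. The order-complement matrix is $\overline{\mathbf Z}=\mathbf J-\mathbf Z$, so its $(i,j)$ entry is $0$ if $x_i\leq x_j$ and $1$ otherwise. A chain of length $k$ in $P$ is a subset $\{y_0,y_1,\ldots,y_k\}\subseteq P$ with $y_0<y_1<\cdots<y_k$ (so it has $k+1$ elements and $k$ strict comparisons). The Euler characteristic of $P$ is $\chi(P)=c_0-c_1+c_2-\cdots+(-1)^{n-1}c_{n-1}$, where $c_k$ is the number of chains of length $k$ in $P$, and the reduced Euler characteristic is $\tilde\chi(P)=\chi(P)-1$. The characteristic polynomial of an $n\times n$ matrix $\mathbf M$ is taken here with the convention $\det(\mathbf M-\lambda\mathbf I)$. *)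

(* Defs.v *)
From mathcomp Require Import all_boot all_order all_algebra.

Set Implicit Arguments.
Unset Strict Implicit.
Unset Printing Implicit Defensive.

Import Order.TTheory GRing.Theory.
Local Open Scope ring_scope.

Section Matrices.
Variables (R : comNzRingType) (d : Order.disp_t) (P : finPOrderType d).
Variables (n : nat) (x : 'I_n -> P).

Definition zeta_mx : 'M[R]_n := \matrix_(i, j) ((x i <= x j)%O)%:R.

Definition order_complement_mx : 'M[R]_n := const_mx 1 - zeta_mx.

End Matrices.

Arguments zeta_mx R {d P n} x.
Arguments order_complement_mx R {d P n} x.

(* Sign convention det(M - 'X I); the library's [char_poly M] is det('X I - M). *)
Definition charpoly_sub (R : comNzRingType) (n : nat) (M : 'M[R]_n) : {poly R} :=
  \det (map_mx polyC M - 'X%:M).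

Section Chains.
Variables (d : Order.disp_t) (P : finPOrderType d).

(* The length k counts strict comparisons, so such a chain has k + 1 elements. *)
Definition is_chain (k : nat) (A : {set P}) : bool :=
  [exists y : k.+1.-tuple P, sorted <%O y && (A == [set z in y])].

Definition chain_count (k : nat) : nat := #|[set A : {set P} | is_chain k A]|.

Definition euler_char : int := \sum_(k < #|P|) (-1) ^+ k * (chain_count k)%:Z.

Definition reduced_euler_char : int := euler_char - 1.

End Chains.

Arguments chain_count {d} P k.
Arguments euler_char {d} P.
Arguments reduced_euler_char {d} P.

(* Main.v *)
Require Import Defs.
From mathcomp Require Import all_boot all_order all_algebra.
From mathcomp Require Import perm.

(** Let N = Z - I be the strict zeta matrix and t = 'X + 1. Then
    the complement minus 'X times the identity is -(t I + N - J), so the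
    characteristic polynomial is (-1)^n det(t I + N - u u^T), where u is the
    all-ones column and J = u u^T.

    Up to a linear extension of the order, N is strictly upper triangular, so
    det(t I + N) = t^n and N^n = 0 ([det_scalar_add_strict_zeta],
    [strict_zeta_nilpotent]). Hence the Neumann series for the inverse of
    t I + N stops, and after clearing denominators it is the matrix
      B = sum_(k < n) (-1)^k t^(n-1-k) N^k,   with (t I + N) B = t^n I.
    The matrix determinant lemma, in the denominator-free form
    [det_rank1_update], gives
      t^n det(t I + N - J) = t^n (t^n - u^T B u),
    and t^n, being monic, can be cancelled. The scalars u^T N^k u occurring in
    u^T B u count the sequences y_0 < ... < y_k, that is, the chains of length
    k ([strict_zeta_chain_count]), which yields the formula for the
    characteristic polynomial. The determinant is its value at 0, where every
    power of t evaluates to 1 and the sum becomes the Euler characteristic. *)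

Set Implicit Arguments.
Unset Strict Implicit.
Unset Printing Implicit Defensive.

Import Order.TTheory GRing.Theory.
Local Open Scope ring_scope.

(** A chain has exactly one increasing enumeration, so counting subsets and
    counting sorted tuples agree. *)
Lemma chain_count_sorted (d : Order.disp_t) (P : finPOrderType d) (k : nat) :
  chain_count P k = #|[set y : k.+1.-tuple P | sorted <%O y]|.
Proof.
rewrite /chain_count.
rewrite -(@card_in_imset _ _ (fun y : k.+1.-tuple P => [set z in y])).
  congr #|pred_of_set _|; apply/setP=> A; rewrite inE.
  apply/existsP/imsetP=> [[y /andP[y_s /eqP->]]|[y]].
    by exists y; rewrite ?inE.
  by rewrite inE => y_s ->; exists y; rewrite y_s /=.
move=> y1 y2; rewrite !inE => s1 s2 /setP eq12; apply: val_inj.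
by apply: lt_sorted_eq => // z; have := eq12 z; rewrite !inE.
Qed.

Lemma big_tuple_cons (S : nmodType) (T : finType) (k : nat)
    (F : k.+1.-tuple T -> S) :
  \sum_y F y = \sum_(p : T) \sum_(y : k.-tuple T) F [tuple of p :: y].
Proof.
rewrite pair_big /=.
rewrite (reindex (fun u : T * k.-tuple T => [tuple of u.1 :: u.2])) //=.
exists (fun y => (thead y, [tuple of behead y])).
  by move=> [p y] _ /=; rewrite theadE; congr (_, _); apply: val_inj.
by move=> y _; rewrite /= -tuple_eta.
Qed.

Section ZetaMatrix.
Variables (R : comNzRingType) (d : Order.disp_t) (P : finPOrderType d).
Variables (n : nat) (x : 'I_n -> P).
Hypothesis x_bij : bijective x.

Lemma strict_zetaE i j : (zeta_mx R x - 1%:M) i j = (x i < x j)%O%:R.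
Proof.
rewrite !mxE lt_def -(inj_eq (bij_inj x_bij)) [x j == _]eq_sym.
by case: eqP => [->|_] /=; rewrite ?lexx ?subrr ?subr0.
Qed.

(** The vertex [x i] is kept out of the tuple [y]: this makes the induction on
    [k] peel off the first step of the walk, as the leftmost factor of the
    power of the matrix does. *)
Lemma strict_zeta_walks k i :
  ((zeta_mx R x - 1%:M) ^+ k *m (const_mx 1 : 'cV[R]_n)) i 0
  = \sum_(y : k.-tuple P) (path <%O (x i) y)%:R.
Proof.
elim: k i => [|k IHk] i.
  rewrite expr0 mul1mx mxE (big_pred1 [tuple]) //= => y.
  by rewrite [y]tuple0; apply/esym/eqP.
rewrite exprS -mulmxA mxE big_tuple_cons [RHS](reindex x) /=; last first.
  exact: onW_bij.
apply: eq_bigr => j _; rewrite IHk strict_zetaE mulr_sumr.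
by apply: eq_bigr => y _; rewrite -natrM mulnb.
Qed.

Lemma strict_zeta_chain_count k :
  ((const_mx 1 : 'cV[R]_n)^T *m (zeta_mx R x - 1%:M) ^+ k
     *m (const_mx 1 : 'cV[R]_n)) 0 0 = (chain_count P k)%:R.
Proof.
rewrite -mulmxA mxE chain_count_sorted -sum1_card natr_sum [RHS]big_mkcond.
rewrite big_tuple_cons [RHS](reindex x) /=; last exact: onW_bij.
apply: eq_bigr => i _; rewrite strict_zeta_walks !mxE mul1r.
by apply: eq_bigr => y _; rewrite inE /=; case: path.
Qed.

End ZetaMatrix.

(** Following the f-orbit of i, the labels increase and come back to their
    starting value, so they are all equal. *)
Lemma injective_inflationary_fixed (I : finType) (d : Order.disp_t)
    (P : porderType d) (x : I -> P) (f : I -> I) :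
  injective f -> (forall i, (x i <= x (f i))%O) -> forall i, x (f i) = x i.
Proof.
move=> f_inj x_le i; apply/le_anti; rewrite x_le andbT.
have le_iter m : (x (f i) <= x (iter m.+1 f i))%O.
  by elim: m => [|m IHm]; [exact: lexx | exact: le_trans IHm (x_le _)].
by rewrite -[in leRHS](iter_order f_inj i) -[order f i]prednK // order_gt0.
Qed.

(** The determinant of a triangular matrix, without choosing a linear
    extension of the order: in the Leibniz formula a permutation s contributes
    only if x i <= x (s i) for all i, and then
    [injective_inflationary_fixed] forces s to be the identity. *)
Lemma det_incidence (R : comNzRingType) (d : Order.disp_t) (P : porderType d)
    (n : nat) (x : 'I_n -> P) (M : 'M[R]_n) :
  injective x -> (forall i j, ~~ (x i <= x j)%O -> M i j = 0) ->
  \det M = \prod_i M i i.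
Proof.
move=> x_inj M0; rewrite /determinant (bigD1 (1%g : 'S_n)) //=.
rewrite [X in _ + X]big1 ?addr0.
  by rewrite odd_perm1 expr0 mul1r; apply: eq_bigr => i _; rewrite perm1.
move=> s s_neq1; have [/forallP s_le|] := boolP [forall i, x i <= x (s i)]%O.
  case/eqP: s_neq1; apply/permP=> i; rewrite perm1; apply: x_inj.
  exact: injective_inflationary_fixed (@perm_inj _ s) s_le i.
rewrite negb_forall => /existsP[i /M0 Mi0].
by rewrite (bigD1 i) //= Mi0 mul0r mulr0.
Qed.

Lemma det_scalar_add_strict_zeta (R : comNzRingType) (d : Order.disp_t)
    (P : finPOrderType d) (n : nat) (x : 'I_n -> P) (t : R) :
  bijective x -> \det (t%:M + (zeta_mx R x - 1%:M)) = t ^+ n.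
Proof.
move=> x_bij; rewrite (det_incidence (bij_inj x_bij)).
  rewrite -[in RHS](card_ord n) -prodr_const; apply: eq_bigr => i _.
  by rewrite mxE strict_zetaE // ltxx addr0 mxE eqxx.
move=> i j nle_ij; rewrite mxE strict_zetaE // !mxE.
rewrite (contraNF (@ltW _ _ _ _)) //.
by case: eqP nle_ij => [->|_ _]; rewrite ?lexx ?addr0.
Qed.

(** As an incidence matrix with zero diagonal, N has characteristic polynomial
    'X^n; the theorem of Cayley and Hamilton concludes. *)
Lemma strict_zeta_nilpotent (R : comNzRingType) (d : Order.disp_t)
    (P : finPOrderType d) (n : nat) (x : 'I_n -> P) :
  bijective x -> (zeta_mx R x - 1%:M) ^+ n = 0.
Proof.
move=> x_bij; case: n x x_bij => [|n] x x_bij; first by apply/matrixP=> [[]].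
set N := _ - _; have charN : char_poly N = 'X^(n.+1).
  rewrite /char_poly (det_incidence (bij_inj x_bij)).
    rewrite -[in RHS](card_ord n.+1) -prodr_const; apply: eq_bigr => i _.
    by rewrite !mxE eqxx lexx subrr subr0.
  move=> i j nle_ij; rewrite /char_poly_mx mxE [X in _ + X]mxE [X in - X]mxE.
  rewrite /N strict_zetaE // mxE.
  rewrite (contraNF (@ltW _ _ _ _)) // subr0.
  by case: eqP nle_ij => [->|_ _]; rewrite ?lexx.
by have := Cayley_Hamilton N; rewrite charN rmorphXn /= horner_mx_X.
Qed.

(** The matrix determinant lemma for a quasi-inverse B of A. The bordered
    matrix W with blocks 1, v, u, A is reduced in two ways by column
    operations: clearing v leaves the Schur complement A - u v, and clearing u
    with the help of B, after scaling the first column by a, leaves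
    a - v B u next to A. *)
Lemma det_rank1_update (R : comNzRingType) (n : nat) (A B : 'M[R]_n) (a : R)
    (u : 'cV[R]_n) (v : 'rV[R]_n) :
  A *m B = a%:M ->
  a * \det (A - u *m v) = \det A * (a - (v *m B *m u) 0 0).
Proof.
move=> AB; pose W : 'M_(1 + n) := block_mx 1%:M v u A.
have detW : \det W = \det (A - u *m v).
  have := det_mulmx W (block_mx 1%:M (- v) 0 1%:M).
  rewrite mulmx_block !mulmx1 !mulmx0 !addr0 mul1mx addNr mulmxN addrC.
  by rewrite det_lblock det_ublock !det1 mul1r !mulr1.
have := det_mulmx W (block_mx a%:M 0 (- (B *m u)) 1%:M).
rewrite mulmx_block !mulmxN !mulmx1 !mulmx0 !add0r mul1mx [A *m _]mulmxA AB.
rewrite mul_scalar_mx mul_mx_scalar subrr det_ublock det_lblock.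
rewrite det1 det_scalar1 mulr1 detW => detE; rewrite mulrC -detE mulrC.
by congr (_ * _); rewrite det_mx11 mulmxA !mxE mulr1n.
Qed.

(** The regularity of t, which holds for the monic polynomial 'X + 1, replaces
    invertibility over a ring that need not be a domain. *)
Lemma det_scalar_add_strict_zeta_sub_ones (S : comNzRingType)
    (d : Order.disp_t) (P : finPOrderType d) (n : nat) (x : 'I_n -> P) (t : S) :
  bijective x -> GRing.lreg t ->
  \det (t%:M + (zeta_mx S x - 1%:M) - const_mx 1)
  = t ^+ n - \sum_(k < n) (-1) ^+ k * (chain_count P k)%:R * t ^+ (n - 1 - k).
Proof.
move=> x_bij t_reg; set N := zeta_mx S x - 1%:M.
pose B : 'M[S]_n := \sum_(k < n) t%:M ^+ (n.-1 - k) * (- N) ^+ k.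
have scalX m : (t%:M : 'M_n) ^+ m = (t ^+ m)%:M.
  elim: m => [|m IHm]; rewrite ?expr0 // !exprS IHm.
  by rewrite [LHS]mul_scalar_mx scale_scalar_mx.
(* This is the factorization of t^n - (-N)^n, in which (-N)^n = 0. *)
have AB : (t%:M + N) *m B = (t ^+ n)%:M.
  have commN : GRing.comm (t%:M : 'M_n) (- N) by apply/esym/scalar_mxC.
  rewrite -[_ *m B]/((t%:M + N) * B) -[N in LHS]opprK -(subrXX_comm n commN).
  by rewrite exprNn strict_zeta_nilpotent // mulr0 subr0 scalX.
have onesE : const_mx 1 = (const_mx 1 : 'cV[S]_n) *m (const_mx 1 : 'cV_n)^T.
  by apply/matrixP=> i j; rewrite [RHS]mxE big_ord1 !mxE mulr1.
apply: (lregX t_reg (n := n)); rewrite onesE (det_rank1_update _ _ AB).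
rewrite det_scalar_add_strict_zeta //; congr (_ * (_ - _)).
rewrite /B mulmx_sumr mulmx_suml summxE; apply: eq_bigr => k _.
rewrite scalX [_%:M * _]mul_scalar_mx -subn1.
have -> : (- N) ^+ k = (-1) ^+ k *: N ^+ k.
  by rewrite (exprNn N) -signr_odd mulr_sign -scaler_sign signr_odd.
rewrite scalerA -scalemxAr -scalemxAl mxE strict_zeta_chain_count //.
by rewrite [RHS]mulrC mulrA.
Qed.

Theorem theorem1 (R : comNzRingType) (d : Order.disp_t) (P : finPOrderType d)
    (n : nat) (x : 'I_n -> P) (x_bij : bijective x) :
  [/\ forall k : nat,
        ((const_mx 1 : 'cV[R]_n)^T *m (zeta_mx R x - 1%:M) ^+ k
           *m (const_mx 1 : 'cV[R]_n)) 0 0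
        = (chain_count P k)%:R,
      charpoly_sub (order_complement_mx R x)
        = (-1) ^+ n * ('X + 1) ^+ n
          - \sum_(k < n) (-1) ^+ (k + n) * (chain_count P k)%:R
                           * ('X + 1) ^+ (n - 1 - k)
    & \det (order_complement_mx R x)
        = (-1) ^+ (n + 1) * (reduced_euler_char P)%:~R].
Proof.
have charE : charpoly_sub (order_complement_mx R x)
    = (-1) ^+ n * ('X + 1) ^+ n
      - \sum_(k < n) (-1) ^+ (k + n) * (chain_count P k)%:R
                       * ('X + 1) ^+ (n - 1 - k).
  have X1_reg : GRing.lreg ('X + 1 : {poly R}).
    by apply: monic_lreg; rewrite -[1]opprK -[- 1](rmorphN1 polyC) monicXsubC.
  rewrite /charpoly_sub.
  (* The entries 0 and 1 make sense over any ring, so the zeta matrix can be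
     taken directly over the polynomials. *)
  have -> : map_mx polyC (order_complement_mx R x) - 'X%:M
      = - (('X + 1)%:M + (zeta_mx {poly R} x - 1%:M) - const_mx 1).
    apply/matrixP=> i j; rewrite !mxE rmorphB /= rmorph1 rmorph_nat mulrnDl.
    rewrite opprB -[_ + _ + (_ - _)]addrA [_%:R + (_ - _)]addrC subrK.
    by rewrite opprD addrA addrAC.
  rewrite -scaleN1r detZ det_scalar_add_strict_zeta_sub_ones //.
  rewrite mulrBr mulr_sumr; congr (_ - _); apply: eq_bigr => k _.
  by rewrite addnC exprD !mulrA.
split=> //; first by move=> k; apply: strict_zeta_chain_count.
have cardP : #|P| = n by rewrite -(card_ord n) (bij_eq_card x_bij).
have -> : \det (order_complement_mx R x)
    = (charpoly_sub (order_complement_mx R x)).[0].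
  rewrite -horner_evalE -det_map_mx; congr (\det _); apply/matrixP=> i j.
  by rewrite !mxE /= horner_evalE !hornerE hornerMn hornerX mul0rn subr0.
have X1_0 m : horner_eval 0 (('X + 1 : {poly R}) ^+ m) = 1.
  by rewrite horner_evalE horner_exp !hornerE expr1n.
rewrite charE -horner_evalE rmorphB rmorphM rmorph_sign /= X1_0 mulr1.
rewrite /reduced_euler_char /euler_char cardP rmorphB rmorph1 mulrBr mulr1.
rewrite exprD expr1 mulrN1 opprK addrC mulNr rmorph_sum /= rmorph_sum mulr_sumr.
congr (- _ + _); apply: eq_bigr => k _.
rewrite !rmorphM /= X1_0 mulr1 rmorph_sign rmorph_nat rmorph_sign.
by rewrite addnC exprD mulrA.
Qed.
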